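(* Let $F$ be a field of characteristic zero, $W$ a unital $F$-algebra, $k\geq 2$, and let $M_k$ be the $W$-algebra $M_k(F)$ of $k\times k$ matrices, where $W$ acts on it as $M_k(F)$ itself by left and right multiplication, with a basis of $W$ fixed as described in the context. Then $\mathrm{Id}^W(M_k)$ is generated as a $T_W$-ideal by the $W$-polynomials $$[w_{11}x_1w_{11},\,w_{11}x_2w_{11}],\quad w_{ij}w_{ml}x-\delta_{jm}w_{il}x,\quad xw_{ij}w_{ml}-\delta_{jm}xw_{il},\quad w_{pq}x,\quad xw_{pq},$$ where $i,j,l,m\in\{1,\ldots,k\}$, $\delta_{jm}$ is the Kronecker delta, and $w_{pq}$ runs over the basis elements for which at least one of $p,q$ is greater than $k$. Moreover, $c_n^W(M_k)=k^{2(n+1)}$ for all $n\geq 1$.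
   Context: All algebras are associative over a field $F$ of characteristic zero; $W$ is a unital $F$-algebra. A $W$-algebra is an $F$-algebra $A$ that is a unital $W$-bimodule (so $(w_1a)w_2=w_1(aw_2)$ and $1_Wa=a1_W=a$) such that $(a_1a_2)w=a_1(a_2w)$, $w(a_1a_2)=(wa_1)a_2$, $(a_1w)a_2=a_1(wa_2)$ for all $a_1,a_2\in A$, $w\in W$. Homomorphisms of $W$-algebras are algebra homomorphisms commuting with both actions. The free $W$-algebra $W\langle X\rangle$ on $X=\{x_1,x_2,\ldots\}$ has $F$-basis $\{w_{i_0}x_{j_1}w_{i_1}x_{j_2}\cdots x_{j_n}w_{i_n}\mid n\geq 1\}$, where the $w_{i_r}$ run over a fixed basis of $W$ and $j_1,\dots,j_n\ge 1$ (expressions are multilinear in the $W$-entries); the product is juxtaposition followed by multiplication in $W$, $W$ acts by multiplying the outer entries, and $x_i=1_Wx_i1_W$ (so $W$ itself is not contained in $W\langle X\rangle$). Its elements are called $W$-polynomials. A $T_W$-ideal is a two-sided ideal of $W\langle X\rangle$ stable under left and right multiplication by $W$ and under all $W$-algebra endomorphisms of $W\langle X\rangle$. $\mathrm{Id}^W(A)$ is the set of $f\in W\langle X\rangle$ vanishing under all evaluations of the variables in the $W$-algebra $A$. $P_n^W$ is the space of multilinear $W$-polynomials in $x_1,\dots,x_n$, and $c_n^W(A)=\dim_F P_n^W/(P_n^W\cap \mathrm{Id}^W(A))$. Also $[a,b]=ab-ba$. A multiplier of $A$ is a pair $(R,L)$ of linear endomorphisms of $A$ with $R(ab)=aR(b)$,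 $L(ab)=L(a)b$, $R(a)b=aL(b)$; $\mathcal M(A)$ is the algebra of multipliers (product $(R_1,L_1)(R_2,L_2)=(R_2R_1,L_1L_2)$). The acting homomorphism $\Phi:W\to\mathcal M(A)$ of a $W$-algebra $A$ sends $w$ to $(a\mapsto aw,\ a\mapsto wa)$. For $m\in A$, $R_m(a)=am$ and $L_m(a)=ma$. ''$W$ acts on $M_k(F)$ as $M_k(F)$ itself by left and right multiplication'' means $\Phi(W)=\{(R_a,L_a)\mid a\in M_k(F)\}\cong M_k(F)$. A basis of $W$ is fixed that contains elements $w_{ij}$, $1\leq i,j\leq k$, with $\Phi(w_{ij})=(R_{e_{ij}},L_{e_{ij}})$ ($e_{ij}$ the matrix units), and whose remaining elements, denoted $w_{pq}$ with $p>k$ or $q>k$, all lie in $\ker\Phi$. *)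

(* Defs.v *)
From HB Require Import structures.
From mathcomp Require Import all_boot all_order all_algebra.
From mathcomp Require Import finmap.
From mathcomp Require Import monalg.

Set Implicit Arguments.
Unset Strict Implicit.
Unset Printing Implicit Defensive.

Import GRing.Theory.
Local Open Scope ring_scope.

(* [{malg F[K]}] is used, for an arbitrary [K : choiceType], as the F-vector  *)
(* space of finitely supported functions K -> F, with basis [<< m >>], m : K. *)

Section LinExt.
Context (F : fieldType) (K : choiceType) (V : lmodType F).
Implicit Types (h : K -> V) (f : {malg F[K]}).

Definition lin_ext h f : V := \sum_(m <- msupp f) f@_m *: h m.

Lemma lin_extEw h f (d : {fset K}) : (msupp f `<=` d)%fset ->
  lin_ext h f = \sum_(m <- d) f@_m *: h m.
Proof.
move=> le; rewrite /lin_ext (big_fset_incl _ le) // => m _ mf.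
by rewrite mcoeff_outdom // scale0r.
Qed.

Lemma lin_ext_is_linear h : linear (lin_ext h).
Proof.
move=> a f g; pose d := (msupp (a *: f + g) `|` (msupp f `|` msupp g))%fset.
have le1 : (msupp (a *: f + g) `<=` d)%fset by apply: fsubsetUl.
have le2 : (msupp f `<=` d)%fset.
  by apply: fsubset_trans (fsubsetUr _ _); apply: fsubsetUl.
have le3 : (msupp g `<=` d)%fset.
  by apply: fsubset_trans (fsubsetUr _ _); apply: fsubsetUr.
rewrite (lin_extEw _ le1) (lin_extEw _ le2) (lin_extEw _ le3).
rewrite scaler_sumr -big_split /=; apply: eq_bigr => m _.
by rewrite mcoeffD mcoeffZ scalerDl scalerA.
Qed.

HB.instance Definition _ h :=
  GRing.isLinear.Build F {malg F[K]} V *:%R (lin_ext h) (lin_ext_is_linear h).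

Lemma lin_extU h m : lin_ext h << m >> = h m.
Proof. by rewrite /lin_ext msuppU oner_eq0 big_seq_fset1 mcoeffUU scale1r. Qed.

Lemma malg_lin_ind (P : {malg F[K]} -> Prop) :
    P 0 -> (forall a f g, P f -> P g -> P (a *: f + g)) ->
    (forall m, P << m >>) -> forall f, P f.
Proof.
move=> P0 PD PU f; rewrite [f]monalgE.
elim: (enum_fset (msupp f)) => [|m s IHs]; first by rewrite big_nil.
rewrite big_cons (_ : << f@_m *g m >> = f@_m *: << m >>); first exact: PD.
by apply/malgP => m'; rewrite mcoeffZ !mcoeffU mulrnAr mulr1.
Qed.

Lemma lin_ext_uniq h (phi : {malg F[K]} -> V) : linear phi ->
  (forall m, phi << m >> = h m) -> phi =1 lin_ext h.
Proof.
move=> lin_phi phiU; have phi0 : phi 0 = 0.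
  by have := lin_phi (-1) 0 0; rewrite scaler0 addr0 scaleN1r addNr.
elim/malg_lin_ind => [|a f g IHf IHg|m]; first by rewrite phi0 linear0.
  by rewrite lin_phi linearP IHf IHg.
by rewrite phiU lin_extU.
Qed.

End LinExt.

(* Bases of the (possibly infinite-dimensional) algebra W, as indexed         *)
(* families.                                                                  *)
Section Basis.
Context (F : fieldType) (W : lmodType F) (I : choiceType).

Definition is_basis (b : I -> W) : Prop :=
  forall v : W, exists! c : {malg F[I]}, lin_ext b c = v.

Record basis := Basis { bvec :> I -> W; basisP : is_basis bvec }.

Lemma coord_subproof (b : basis) (v : W) :
  exists c : {malg F[I]}, lin_ext b c == v.
Proof. by have [c [<- _]] := basisP b v; exists c. Qed.

Definition bcoord (b : basis) (v : W) : {malg F[I]} :=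
  xchoose (coord_subproof b v).

Lemma bcoordK (b : basis) : cancel (bcoord b) (lin_ext b).
Proof. by move=> v; apply/eqP/(xchooseP (coord_subproof b v)). Qed.

Lemma lin_extK (b : basis) : cancel (lin_ext b) (bcoord b).
Proof.
move=> c; have [c' [_ uniq_c]] := basisP b (lin_ext b c).
by rewrite -[LHS](uniq_c _ (bcoordK b _)) -[RHS](uniq_c c erefl).
Qed.

Lemma bcoord_is_linear (b : basis) : linear (bcoord b).
Proof.
move=> a u v; apply: (can_inj (lin_extK b)).
by rewrite lin_ext_is_linear !bcoordK.
Qed.

HB.instance Definition _ (b : basis) :=
  GRing.isLinear.Build F W {malg F[I]} *:%R (bcoord b) (bcoord_is_linear b).

Lemma lin_ext_bcoord (b : basis) (V : lmodType F) (phi : W -> V) (v : W) :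
  linear phi -> lin_ext (phi \o b) (bcoord b v) = phi v.
Proof.
move=> lin_phi; rewrite -[in RHS](bcoordK b v); symmetry.
apply: (@lin_ext_uniq _ _ _ _ (phi \o lin_ext b)) => [a f g|m] /=.
  by rewrite linearP lin_phi.
by rewrite lin_extU.
Qed.

End Basis.

Section WAlgebra.
Context (F : fieldType) (W : algType F).

Record is_walgebra (A : lmodType F) (mul : A -> A -> A)
    (lact : W -> A -> A) (ract : A -> W -> A) : Prop := IsWAlgebra {
  mul_linl : forall a, linear (mul^~ a);
  mul_linr : forall a, linear (mul a);
  wmulA : associative mul;
  lact_linl : forall a, linear (lact^~ a);
  lact_linr : forall w, linear (lact w);
  ract_linl : forall w, linear (ract^~ w);
  ract_linr : forall a, linear (ract a);
  lact1 : forall a, lact 1 a = a;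
  lactM : forall w1 w2 a, lact (w1 * w2) a = lact w1 (lact w2 a);
  ract1 : forall a, ract a 1 = a;
  ractM : forall w1 w2 a, ract a (w1 * w2) = ract (ract a w1) w2;
  lractA : forall w1 a w2, ract (lact w1 a) w2 = lact w1 (ract a w2);
  ract_mul : forall a1 a2 w, ract (mul a1 a2) w = mul a1 (ract a2 w);
  lact_mul : forall w a1 a2, lact w (mul a1 a2) = mul (lact w a1) a2;
  mul_mid : forall a1 w a2, mul (ract a1 w) a2 = mul a1 (lact w a2)
}.

Structure walgebra := WAlgebra {
  wcar :> lmodType F;
  wmul : wcar -> wcar -> wcar;
  wlact : W -> wcar -> wcar;
  wract : wcar -> W -> wcar;
  walgP : is_walgebra wmul wlact wract
}.

Definition wbracket (A : walgebra) (a b : A) : A := wmul a b - wmul b a.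

Record is_whom (A B : walgebra) (phi : A -> B) : Prop := IsWHom {
  whom_linear : linear phi;
  whomM : forall a1 a2, phi (wmul a1 a2) = wmul (phi a1) (phi a2);
  whom_lact : forall w a, phi (wlact w a) = wlact w (phi a);
  whom_ract : forall a w, phi (wract a w) = wract (phi a) w
}.

Section Multipliers.
Context (A : walgebra).

Record is_multiplier (RL : (A -> A) * (A -> A)) : Prop := IsMultiplier {
  multR_linear : linear RL.1;
  multL_linear : linear RL.2;
  multR : forall a b, RL.1 (wmul a b) = wmul a (RL.1 b);
  multL : forall a b, RL.2 (wmul a b) = wmul (RL.2 a) b;
  multRL : forall a b, wmul (RL.1 a) b = wmul a (RL.2 b)
}.

(* Equality in the multiplier algebra. *)
Definition mult_eq (m1 m2 : (A -> A) * (A -> A)) : Prop :=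
  (m1.1 =1 m2.1) /\ (m1.2 =1 m2.2).

Definition mult0 : (A -> A) * (A -> A) := (fun=> 0, fun=> 0).

Definition inner_mult (m : A) : (A -> A) * (A -> A) :=
  (fun a => wmul a m, fun a => wmul m a).

Definition acting_hom (w : W) : (A -> A) * (A -> A) :=
  (fun a => wract a w, fun a => wlact w a).

Lemma acting_hom_multiplier w : is_multiplier (acting_hom w).
Proof.
have AP := walgP A; split=> /= *.
- exact: (ract_linl AP).
- exact: (lact_linr AP).
- exact: (ract_mul AP).
- exact: (lact_mul AP).
- exact: (mul_mid AP).
Qed.

Definition acts_as_itself : Prop :=
  (forall w : W, exists a : A, mult_eq (acting_hom w) (inner_mult a)) /\
  (forall a : A, exists w : W, mult_eq (acting_hom w) (inner_mult a)).

End Multipliers.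

Section FreeWAlgebra.
Context (I : choiceType) (b : basis W I).

(* ((i_0, j_1), [:: (i_1, j_2); ...; (i_(n-1), j_n)], i_n) encodes the basis  *)
(* monomial w_(i_0) x_(j_1) w_(i_1) x_(j_2) ... x_(j_n) w_(i_n), n >= 1. The  *)
(* variables are numbered from 0.                                             *)
Definition wmono : Type := ((I * nat) * seq (I * nat) * I)%type.
HB.instance Definition _ := Choice.on wmono.

Definition freeW_car : lmodType F := {malg F[wmono]}.

Definition mono_mul (m m' : wmono) : freeW_car :=
  let: (h, s, l) := m in let: ((i, j), s', l') := m' in
  lin_ext (fun c => << ((h, s ++ (c, j) :: s', l') : wmono) >> : freeW_car)
          (bcoord b (b l * b i)).

Definition mono_lact (w : W) (m : wmono) : freeW_car :=
  let: ((i, j), s, l) := m in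
  lin_ext (fun c => << (((c, j), s, l) : wmono) >> : freeW_car)
          (bcoord b (w * b i)).

Definition mono_ract (w : W) (m : wmono) : freeW_car :=
  let: (h, s, l) := m in
  lin_ext (fun c => << ((h, s, c) : wmono) >> : freeW_car)
          (bcoord b (b l * w)).

Definition freeW_mul (f g : freeW_car) : freeW_car :=
  lin_ext (fun m => lin_ext (mono_mul m) g) f.
Definition freeW_lact (w : W) (f : freeW_car) : freeW_car :=
  lin_ext (mono_lact w) f.
Definition freeW_ract (f : freeW_car) (w : W) : freeW_car :=
  lin_ext (mono_ract w) f.

Lemma lin_ext_eq (V : lmodType F) (K : choiceType) (h h' : K -> V) :
  h =1 h' -> lin_ext h =1 lin_ext h'.
Proof. by move=> hh' f; apply: eq_bigr => m _; rewrite hh'. Qed.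

Lemma lin_ext_comp (K : choiceType) (V V' : lmodType F) (h : K -> V)
    (phi : V -> V') (f : {malg F[K]}) :
  linear phi -> phi (lin_ext h f) = lin_ext (phi \o h) f.
Proof.
move=> lin_phi; apply: (@lin_ext_uniq _ _ _ _ (phi \o lin_ext h)) => [a u v|m] /=.
  by rewrite linearP lin_phi.
by rewrite lin_extU.
Qed.

Lemma lin_ext_linl (K : choiceType) (V U : lmodType F) (H : U -> K -> V)
    (f : {malg F[K]}) :
  (forall m, linear (H^~ m)) -> linear (fun u => lin_ext (H u) f).
Proof.
move=> linH a u v; rewrite /lin_ext scaler_sumr -big_split /=.
by apply: eq_bigr => m _; rewrite linH scalerDr !scalerA mulrC.
Qed.

Lemma exchange_lin_ext (K K' : choiceType) (V : lmodType F) (H : K -> K' -> V)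
    (f : {malg F[K]}) (g : {malg F[K']}) :
  lin_ext (fun m => lin_ext (H m) g) f =
  lin_ext (fun m' => lin_ext (H^~ m') f) g.
Proof.
rewrite /lin_ext; under eq_bigr do rewrite scaler_sumr.
rewrite exchange_big; apply: eq_bigr => m' _; rewrite scaler_sumr.
by apply: eq_bigr => m _; rewrite !scalerA mulrC.
Qed.

Lemma freeW_mul_linl g : linear (freeW_mul^~ g).
Proof. exact: lin_ext_is_linear. Qed.

Lemma freeW_mul_linr f : linear (freeW_mul f).
Proof. by apply: lin_ext_linl => m; apply: lin_ext_is_linear. Qed.

Lemma freeW_lact_linr w : linear (freeW_lact w).
Proof. exact: lin_ext_is_linear. Qed.

Lemma freeW_ract_linl w : linear (freeW_ract^~ w).
Proof. exact: lin_ext_is_linear. Qed.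

Lemma mono_lact_lin m : linear (mono_lact^~ m).
Proof. by case: m => [[[i j] s] l] a u v /=; rewrite mulrDl -scalerAl !linearP. Qed.

Lemma mono_ract_lin m : linear (mono_ract^~ m).
Proof. by case: m => [[h s] l] a u v /=; rewrite mulrDr -scalerAr !linearP. Qed.

Lemma freeW_lact_linl f : linear (freeW_lact^~ f).
Proof. exact/lin_ext_linl/mono_lact_lin. Qed.

Lemma freeW_ract_linr f : linear (freeW_ract f).
Proof. exact/lin_ext_linl/mono_ract_lin. Qed.

Lemma freeW_mulU m m' : freeW_mul << m >> << m' >> = mono_mul m m'.
Proof. by rewrite /freeW_mul !lin_extU. Qed.

Lemma freeW_lactU w m : freeW_lact w << m >> = mono_lact w m.
Proof. exact: lin_extU. Qed.

Lemma freeW_ractU w m : freeW_ract << m >> w = mono_ract w m.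
Proof. exact: lin_extU. Qed.

Lemma bcoord_absorb (V : lmodType F) (G : I -> V) (v u u' : W) :
  lin_ext (fun c => lin_ext G (bcoord b (u * b c * u'))) (bcoord b v) =
  lin_ext G (bcoord b (u * v * u')).
Proof.
apply: (@lin_ext_bcoord _ _ _ b V (fun x => lin_ext G (bcoord b (u * x * u')))).
by move=> a x y; rewrite mulrDr mulrDl -scalerAr -scalerAl !linearP.
Qed.

Lemma bcoord_absorbl (V : lmodType F) (G : I -> V) (v u : W) :
  lin_ext (fun c => lin_ext G (bcoord b (u * b c))) (bcoord b v) =
  lin_ext G (bcoord b (u * v)).
Proof.
rewrite -[u * v]mulr1 -bcoord_absorb; apply: lin_ext_eq => c.
by rewrite mulr1.
Qed.

Lemma bcoord_absorbr (V : lmodType F) (G : I -> V) (v u : W) :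
  lin_ext (fun c => lin_ext G (bcoord b (b c * u))) (bcoord b v) =
  lin_ext G (bcoord b (v * u)).
Proof.
rewrite -[v * u]mul1r mulrA -bcoord_absorb; apply: lin_ext_eq => c.
by rewrite mul1r.
Qed.

Lemma bcoord_basis (V : lmodType F) (G : I -> V) (i : I) :
  lin_ext G (bcoord b (b i)) = G i.
Proof. by rewrite -[X in bcoord b X](lin_extU b i) lin_extK lin_extU. Qed.

Lemma freeW_eq (V : lmodType F) (phi psi : freeW_car -> V) :
  linear phi -> linear psi -> (forall m, phi << m >> = psi << m >>) ->
  phi =1 psi.
Proof.
move=> lin_phi lin_psi e f.
rewrite (lin_ext_uniq lin_phi (h := fun m => phi << m >>)) //.
by rewrite (lin_ext_uniq lin_psi (h := fun m => phi << m >>)).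
Qed.

Lemma linear_comp (U V V' : lmodType F) (phi : V -> V') (psi : U -> V) :
  linear phi -> linear psi -> linear (phi \o psi).
Proof. by move=> lin1 lin2 a u v; rewrite /= lin2 lin1. Qed.

Lemma freeW_is_walgebra : is_walgebra freeW_mul freeW_lact freeW_ract.
Proof.
have mulL := freeW_mul_linl; have mulR := freeW_mul_linr.
have lR := freeW_lact_linr; have rL := freeW_ract_linl.
split.
- exact: mulL.
- exact: mulR.
- move=> f g h; move: f.
  apply: freeW_eq => [||m1]; first exact: mulL.
    exact: (linear_comp (mulL h) (mulL g)).
  move: g; apply: freeW_eq => [||m2].
  - exact: (linear_comp (mulR _) (mulL h)).
  - exact: (linear_comp (mulL h) (mulR _)).
  move: h; apply: freeW_eq => [||m3].
  - exact: (linear_comp (mulR _) (mulR _)).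
  - exact: (mulR _).
  rewrite !freeW_mulU.
  case: m1 m2 m3 => [[h1 s1] l1] [[[i2 j2] s2] l2] [[[i3 j3] s3] l3] /=.
  rewrite (lin_ext_comp _ _ (mulR _)) (lin_ext_comp _ _ (mulL _)) /=.
  pose T d c : freeW_car :=
    << ((h1, s1 ++ (c, j2) :: s2 ++ (d, j3) :: s3, l3) : wmono) >>.
  transitivity (lin_ext (fun d => lin_ext (T d) (bcoord b (b l1 * b i2)))
                        (bcoord b (b l2 * b i3))).
    by apply: lin_ext_eq => d /=; rewrite freeW_mulU.
  rewrite exchange_lin_ext; apply: lin_ext_eq => c /=; rewrite freeW_mulU /=.
  by apply: lin_ext_eq => d; rewrite -catA.
- exact: freeW_lact_linl.
- exact: lR.
- exact: rL.
- exact: freeW_ract_linr.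
- apply: freeW_eq => // m; rewrite freeW_lactU.
  by case: m => [[[i j] s] l] /=; rewrite mul1r bcoord_basis.
- move=> w1 w2; apply: freeW_eq => [||m]; first exact: lR.
    exact: (linear_comp (lR _) (lR _)).
  rewrite !freeW_lactU; case: m => [[[i j] s] l] /=.
  rewrite (lin_ext_comp _ _ (lR _)) -mulrA -bcoord_absorbl.
  by apply: lin_ext_eq => c; rewrite /= freeW_lactU.
- apply: freeW_eq => // m; rewrite freeW_ractU.
  by case: m => [[h s] l] /=; rewrite mulr1 bcoord_basis.
- move=> w1 w2; apply: freeW_eq => [||m]; first exact: rL.
    exact: (linear_comp (rL _) (rL _)).
  rewrite !freeW_ractU; case: m => [[h s] l] /=.
  rewrite (lin_ext_comp _ _ (rL _)) mulrA -bcoord_absorbr.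
  by apply: lin_ext_eq => c; rewrite /= freeW_ractU.
- move=> w1 f w2; move: f; apply: freeW_eq => [||m].
  - exact: (linear_comp (rL _) (lR _)).
  - exact: (linear_comp (lR _) (rL _)).
  rewrite freeW_lactU freeW_ractU; case: m => [[[i j] s] l] /=.
  rewrite (lin_ext_comp _ _ (lR _)) (lin_ext_comp _ _ (rL _)).
  pose T c d : freeW_car := << (((c, j), s, d) : wmono) >>.
  transitivity (lin_ext (fun c => lin_ext (T c) (bcoord b (b l * w2)))
                        (bcoord b (w1 * b i))).
    by apply: lin_ext_eq => c /=; rewrite freeW_ractU.
  rewrite exchange_lin_ext; apply: lin_ext_eq => c /=.
  by rewrite freeW_lactU.
- move=> f g w; move: f; apply: freeW_eq => [||m1].
  - exact: (linear_comp (rL _) (mulL _)).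
  - exact: mulL.
  move: g; apply: freeW_eq => [||m2].
  - exact: (linear_comp (rL _) (mulR _)).
  - exact: (linear_comp (mulR _) (rL _)).
  rewrite freeW_mulU freeW_ractU.
  case: m1 m2 => [[h1 s1] l1] [[[i2 j2] s2] l2] /=.
  rewrite (lin_ext_comp _ _ (mulR _)) (lin_ext_comp _ _ (rL _)).
  pose T c d : freeW_car := << ((h1, s1 ++ (c, j2) :: s2, d) : wmono) >>.
  transitivity (lin_ext (fun c => lin_ext (T c) (bcoord b (b l2 * w)))
                        (bcoord b (b l1 * b i2))).
    by apply: lin_ext_eq => c /=; rewrite freeW_ractU.
  rewrite exchange_lin_ext; apply: lin_ext_eq => c /=.
  by rewrite freeW_mulU.
- move=> w f g; move: f; apply: freeW_eq => [||m1].
  - exact: (linear_comp (lR _) (mulL _)).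
  - exact: (linear_comp (mulL _) (lR _)).
  move: g; apply: freeW_eq => [||m2].
  - exact: (linear_comp (lR _) (mulR _)).
  - exact: mulR.
  rewrite freeW_mulU freeW_lactU.
  case: m1 m2 => [[[i1 j1] s1] l1] [[[i2 j2] s2] l2] /=.
  rewrite (lin_ext_comp _ _ (mulL _)) (lin_ext_comp _ _ (lR _)).
  pose T c d : freeW_car := << (((d, j1), s1 ++ (c, j2) :: s2, l2) : wmono) >>.
  transitivity (lin_ext (fun c => lin_ext (T c) (bcoord b (w * b i1)))
                        (bcoord b (b l1 * b i2))).
    by apply: lin_ext_eq => c /=; rewrite freeW_lactU.
  rewrite exchange_lin_ext; apply: lin_ext_eq => c /=.
  by rewrite freeW_mulU.
- move=> f w g; move: f; apply: freeW_eq => [||m1].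
  - exact: (linear_comp (mulL _) (rL _)).
  - exact: mulL.
  move: g; apply: freeW_eq => [||m2].
  - exact: mulR.
  - exact: (linear_comp (mulR _) (lR _)).
  rewrite freeW_ractU freeW_lactU.
  case: m1 m2 => [[h1 s1] l1] [[[i2 j2] s2] l2] /=.
  rewrite (lin_ext_comp _ _ (mulR _)) (lin_ext_comp _ _ (mulL _)).
  pose G c : freeW_car := << ((h1, s1 ++ (c, j2) :: s2, l2) : wmono) >>.
  transitivity (lin_ext (fun c => lin_ext G (bcoord b (b c * b i2)))
                        (bcoord b (b l1 * w))).
    by apply: lin_ext_eq => c /=; rewrite freeW_mulU.
  rewrite bcoord_absorbr -mulrA -bcoord_absorbl.
  by apply: lin_ext_eq => c /=; rewrite freeW_mulU.
Qed.

Definition freeW : walgebra := WAlgebra freeW_is_walgebra.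

(* x_j is the element 1_W x_j 1_W. *)
Definition wvar (j : nat) : freeW :=
  lin_ext (fun c => lin_ext (fun d => << (((c, j), [::], d) : wmono) >>)
    (bcoord b 1)) (bcoord b 1) : freeW_car.

Section Evaluation.
Context (A : walgebra) (rho : nat -> A).

Fixpoint weval_mono (h : I * nat) (s : seq (I * nat)) (l : I) : A :=
  wlact (b h.1)
    (if s is h' :: s' then wmul (rho h.2) (weval_mono h' s' l)
     else wract (rho h.2) (b l)).

(* The value of a W-polynomial at x_j := rho j. *)
Definition weval (f : freeW) : A :=
  lin_ext (fun m : wmono => weval_mono m.1.1 m.1.2 m.2) (f : freeW_car).

Lemma weval_linear : linear weval.
Proof. exact: lin_ext_is_linear. Qed.

Lemma weval_monoU (m : wmono) :
  weval (<< m >> : freeW_car) = weval_mono m.1.1 m.1.2 m.2.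
Proof. exact: lin_extU. Qed.

Lemma weval_mono_cat h s l j s' l' (a : A) (u : W) :
    (forall c, weval_mono (c, j) s' l' = wlact (b c) a) ->
  lin_ext (fun c => weval_mono h (s ++ (c, j) :: s') l') (bcoord b (b l * u)) =
  wmul (weval_mono h s l) (wlact u a).
Proof.
move=> ea; have AP := walgP A; elim: s h => [|h' s IHs] h /=.
  pose phi v := wlact (b h.1) (wmul (rho h.2) (wlact v a)).
  transitivity (lin_ext (phi \o b) (bcoord b (b l * u))).
    by apply: lin_ext_eq => c; rewrite /phi /= -ea.
  rewrite lin_ext_bcoord; last first.
    move=> c x y; rewrite /phi (lact_linl AP) (mul_linr AP).
    by rewrite (lact_linr AP).
  rewrite /phi (lactM AP) -(lact_mul AP) (mul_mid AP); congr wlact.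
pose phi x := wlact (b h.1) (wmul (rho h.2) x).
have lin_phi : linear phi.
  by move=> c x y; rewrite /phi (mul_linr AP) (lact_linr AP).
rewrite -[LHS](lin_ext_comp _ _ lin_phi) IHs /phi.
by rewrite (wmulA AP) (lact_mul AP).
Qed.

Lemma weval_hom : is_whom weval.
Proof.
have AP := walgP A; have WP := walgP freeW; have ev := weval_linear.
split=> //.
- move=> f g; move: f; apply: freeW_eq => [||m1].
  + exact: (linear_comp ev (mul_linl WP _)).
  + exact: (linear_comp (mul_linl AP _) ev).
  move: g; apply: freeW_eq => [||m2].
  + exact: (linear_comp ev (mul_linr WP _)).
  + exact: (linear_comp (mul_linr AP _) ev).
  rewrite /= freeW_mulU !weval_monoU.
  case: m1 m2 => [[h1 s1] l1] [[[i2 j2] s2] l2] /=.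
  rewrite (lin_ext_comp _ _ ev).
  have [a ea] : exists a, forall c, weval_mono (c, j2) s2 l2 = wlact (b c) a.
    by case: (s2) => [|h' s'] /=; eexists.
  rewrite ea -(weval_mono_cat _ _ _ _ ea).
  by apply: lin_ext_eq => c /=; rewrite weval_monoU.
- move=> w; apply: freeW_eq => [||m].
  + exact: (linear_comp ev (lact_linr WP _)).
  + exact: (linear_comp (lact_linr AP _) ev).
  rewrite /= freeW_lactU weval_monoU; case: m => [[[i j] s] l] /=.
  rewrite (lin_ext_comp _ _ ev).
  have [a ea] : exists a, forall c, weval_mono (c, j) s l = wlact (b c) a.
    by case: (s) => [|h' s'] /=; eexists.
  rewrite ea -(lactM AP).
  rewrite -[RHS](@lin_ext_bcoord _ _ _ b _ (fun v => wlact v a)).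
    by apply: lin_ext_eq => c /=; rewrite weval_monoU ea.
  exact: (lact_linl AP).
- move=> f w; move: f; apply: freeW_eq => [||m].
  + exact: (linear_comp ev (ract_linl WP _)).
  + exact: (linear_comp (ract_linl AP _) ev).
  rewrite /= freeW_ractU weval_monoU; case: m => [[h s] l] /=.
  rewrite (lin_ext_comp _ _ ev).
  transitivity (lin_ext (weval_mono h s) (bcoord b (b l * w))).
    by apply: lin_ext_eq => c /=; rewrite weval_monoU.
  elim: s h => [|h' s IHs] h /=.
    pose phi v := wlact (b h.1) (wract (rho h.2) v).
    rewrite -[LHS]/(lin_ext (phi \o b) _) lin_ext_bcoord.
      by rewrite /phi (ractM AP) -(lractA AP).
    by move=> c x y; rewrite /phi (ract_linr AP) (lact_linr AP).
  pose phi x := wlact (b h.1) (wmul (rho h.2) x).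
  have lin_phi : linear phi.
    by move=> c x y; rewrite /phi (mul_linr AP) (lact_linr AP).
  by rewrite -[LHS](lin_ext_comp _ _ lin_phi) IHs /phi (lractA AP) (ract_mul AP).
Qed.

Lemma weval_var j : weval (wvar j) = rho j.
Proof.
have AP := walgP A; rewrite /wvar (lin_ext_comp _ _ weval_linear).
transitivity (lin_ext ((fun v => wlact v (rho j)) \o b) (bcoord b 1)).
  apply: lin_ext_eq => c /=; rewrite (lin_ext_comp _ _ weval_linear).
  pose phi v := wlact (b c) (wract (rho j) v).
  transitivity (lin_ext (phi \o b) (bcoord b 1)).
    by apply: lin_ext_eq => d /=; rewrite weval_monoU.
  rewrite lin_ext_bcoord /phi ?(ract1 AP) // => a x y.
  by rewrite (ract_linr AP) (lact_linr AP).
by rewrite lin_ext_bcoord ?(lact1 AP) //; apply: (lact_linl AP).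
Qed.

End Evaluation.

Lemma mono_wvar1 i j l :
  (<< (((i, j), [::], l) : wmono) >> : freeW_car) =
  wlact (b i) (wract (wvar j) (b l)).
Proof.
have lR := freeW_lact_linr; have rL := freeW_ract_linl.
rewrite /= /wvar (lin_ext_comp _ _ (rL _)) (lin_ext_comp _ _ (lR _)) /=.
pose G c : freeW_car := << (((c, j), [::], l) : wmono) >>.
transitivity (lin_ext (fun c => lin_ext G (bcoord b (b i * b c))) (bcoord b 1)).
  by rewrite bcoord_absorbl mulr1 bcoord_basis.
apply: lin_ext_eq => c /=.
rewrite (lin_ext_comp _ _ (rL _)) /=.
pose H d : freeW_car := << (((c, j), [::], d) : wmono) >>.
transitivity (freeW_lact (b i)
  (lin_ext (fun d => lin_ext H (bcoord b (b d * b l))) (bcoord b 1))).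
  by rewrite bcoord_absorbr mul1r bcoord_basis freeW_lactU.
by congr freeW_lact; apply: lin_ext_eq => d /=; rewrite freeW_ractU.
Qed.

Lemma mono_wvar2 i j h s l :
  (<< (((i, j), h :: s, l) : wmono) >> : freeW_car) =
  wlact (b i) (wmul (wvar j) (<< ((h, s, l) : wmono) >> : freeW_car)).
Proof.
have lR := freeW_lact_linr; have mL := freeW_mul_linl.
rewrite /= /wvar (lin_ext_comp _ _ (mL _)) (lin_ext_comp _ _ (lR _)) /=.
pose G c : freeW_car := << (((c, j), h :: s, l) : wmono) >>.
transitivity (lin_ext (fun c => lin_ext G (bcoord b (b i * b c))) (bcoord b 1)).
  by rewrite bcoord_absorbl mulr1 bcoord_basis.
apply: lin_ext_eq => c /=.
rewrite (lin_ext_comp _ _ (mL _)) /=; case: h @G => [i' j'] G.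
pose H d : freeW_car := << (((c, j), (d, j') :: s, l) : wmono) >>.
transitivity (freeW_lact (b i)
  (lin_ext (fun d => lin_ext H (bcoord b (b d * b i'))) (bcoord b 1))).
  by rewrite bcoord_absorbr mul1r bcoord_basis freeW_lactU.
by congr freeW_lact; apply: lin_ext_eq => d /=; rewrite freeW_mulU.
Qed.

(* Together with [weval_hom] and [weval_var]: [freeW] is free on the x_j.     *)
Lemma weval_uniq (A : walgebra) (phi : freeW -> A) :
  is_whom phi -> phi =1 weval (phi \o wvar).
Proof.
move=> [lin_phi phiM phil phir]; apply: freeW_eq => // [|m].
  exact: weval_linear.
rewrite weval_monoU; case: m => [[[i j] s] l] /=.
elim: s i j => [|[i' j'] s IHs] i j /=.
  by rewrite mono_wvar1 phil phir.
by rewrite mono_wvar2 phil phiM IHs.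
Qed.

Definition IdW (A : walgebra) (f : freeW) : Prop :=
  forall rho : nat -> A, weval rho f = 0.

Record is_TWideal (S : freeW -> Prop) : Prop := IsTWideal {
  TW0 : S 0;
  TWD : forall f g, S f -> S g -> S (f + g);
  TWZ : forall (c : F) f, S f -> S (c *: f);
  TWmull : forall f g, S g -> S (wmul f g);
  TWmulr : forall f g, S f -> S (wmul f g);
  TWlact : forall w f, S f -> S (wlact w f);
  TWract : forall f w, S f -> S (wract f w);
  TWendo : forall (phi : freeW -> freeW) f, is_whom phi -> S f -> S (phi f)
}.

Definition TWgen (E : freeW -> Prop) (f : freeW) : Prop :=
  forall S, is_TWideal S -> (forall g, E g -> S g) -> S f.

Definition mono_vars (m : wmono) : seq nat := m.1.1.2 :: unzip2 m.1.2.

(* P_n^W, in the first n variables, numbered 0, ..., n - 1. *)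
Definition multilinear_poly (n : nat) (f : freeW) : Prop :=
  forall m : wmono, m \in msupp (f : freeW_car) ->
    perm_eq (mono_vars m) (iota 0 n).

End FreeWAlgebra.

Arguments IdW {I} b A f.
Arguments TWgen {I b} E f.
Arguments multilinear_poly {I} b n f.

(* dim P / (P `&` Q) = d, for subspaces P and Q of V: some d vectors of P     *)
(* form a basis of P modulo Q.                                                *)
Definition quotient_dim (V : lmodType F) (P Q : V -> Prop) (d : nat) : Prop :=
  exists v : 'I_d -> V, (forall i, P (v i)) /\
    forall f, P f ->
      exists! c : {ffun 'I_d -> F}, Q (f - \sum_(i < d) c i *: v i).

(* c_n^W(A) = d; as P_n^W may be infinite-dimensional, c_n^W(A) is given by a *)
(* relation rather than a function.                                           *)
Definition codimW (I : choiceType) (b : basis W I) (A : walgebra) (n d : nat) :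
    Prop :=
  quotient_dim (multilinear_poly b n) (IdW b A) d.

(* The basis of W is indexed by the pairs (i, j), for the w_ij with           *)
(* 1 <= i, j <= k (numbered from 0), and by an arbitrary type J, for the      *)
(* remaining elements w_pq with p > k or q > k.                               *)
Section MatrixIdentities.
Context (k : nat) (k_gt1 : (1 < k)%N) (J : choiceType).
Context (b : basis W (('I_k * 'I_k) + J)%type).

Local Notation w i j := (b (inl (i, j))).
Local Notation w11 :=
  (b (inl (Ordinal (ltnW k_gt1), Ordinal (ltnW k_gt1)))).
Local Notation x j := (wvar b j).

Inductive matrix_gens : freeW b -> Prop :=
| GenComm : matrix_gens
    (wbracket (wract (wlact w11 (x 0)) w11) (wract (wlact w11 (x 1)) w11))
| GenLeft (i j m l : 'I_k) : matrix_gens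
    (wlact (w i j) (wlact (w m l) (x 0)) - (j == m)%:R *: wlact (w i l) (x 0))
| GenRight (i j m l : 'I_k) : matrix_gens
    (wract (wract (x 0) (w i j)) (w m l) - (j == m)%:R *: wract (x 0) (w i l))
| GenLeft0 (q : J) : matrix_gens (wlact (b (inr q)) (x 0))
| GenRight0 (q : J) : matrix_gens (wract (x 0) (b (inr q))).

End MatrixIdentities.

End WAlgebra.

Arguments mult0 {F W} A.
Arguments IdW {F W I} b A f.
Arguments TWgen {F W I b} E f.
Arguments multilinear_poly {F W I} b n f.
Arguments codimW {F W I} b A n d.
Arguments matrix_gens {F W k} k_gt1 {J} b f.

(* Main.v *)
Require Import Defs.
From HB Require Import structures.
From mathcomp Require Import all_boot all_order all_algebra.
From mathcomp Require Import finmap multiset monalg.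

Set Implicit Arguments.
Unset Strict Implicit.
Unset Printing Implicit Defensive.

Import GRing.Theory.
Local Open Scope mset_scope.
Local Open Scope ring_scope.

(** A monomial all of whose letters are matrix units [w_{p c_1} x_{j_1}
    w_{a_1 c_2} x_{j_2} ... x_{j_n} w_{a_n q}] takes at the matrices
    [x_j := rho j] the value
      [(rho j_1)_{c_1 a_1} ... (rho j_n)_{c_n a_n} e_{pq}],
    a commutative monomial in matrix entries times a matrix unit. It thus
    depends only on the outer indices [p], [q] and on the multiset of the
    entries [(j_r, (c_r, a_r))].

    The generators suffice to perform the same simplification in any T_W-ideal
    containing them. The relations [w_{ij} w_{ml} = delta_{jm} w_{il}] allow us
    to split [w_{ij}] as [w_{i1} w_{1j}], which turns the monomial into
    [w_{p1} Y_1 ... Y_n w_{1q}], where [Y_r = w_{1 c_r} x_{j_r} w_{a_r 1}]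
    lies in the corner [w_{11} W<X> w_{11}]; the commutator generator says that
    the corner is commutative, whence the order of the entries is immaterial
    ([word_perm]). Monomials containing a letter of the kernel of the action are
    in the ideal ([kernel_mono]). Hence every [f] is congruent to a linear
    combination [nf f] of the keys [(p, multiset, q)] ([eqmod_nf]).

    Conversely, [nf f = 0] as soon as [f] is an identity ([IdW_nf]): otherwise
    some commutative polynomial with a nonzero coefficient would vanish
    everywhere. In characteristic zero distinct commutative monomials are
    distinct characters of the multiplicative monoid of points (set one
    variable to 2 and the others to 1), and distinct characters are linearly
    independent by Artin's argument ([mset_val_free]). So identities are exactly
    the [f] with [nf f = 0], which proves that the generators generate.

    The codimensions follow by counting keys. In a multilinear monomial each of
    the [n] variables contributes one entry, so a key amounts to a function from
    the variables to pairs of indices together with the pair [(p, q)], that is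
    [k^(2n) * k^2] possibilities; the words listing the variables in increasing
    order realise each key once. *)

(** * Linear independence of commutative monomials *)

(** Artin's theorem. Subtracting from the dependence evaluated at [u v] the
    multiple by [chi m0 v] of the dependence at [u] removes the character [m0],
    while the coefficient of [m] gets multiplied by [chi m v - chi m0 v], which
    is nonzero for a suitable [v]. *)
Lemma character_independence (F : fieldType) (U : Type) (one : U)
    (mul : U -> U -> U) (K : eqType) (chi : K -> U -> F) :
    (forall m, chi m one = 1) ->
    (forall m u v, chi m (mul u v) = chi m u * chi m v) ->
    (forall m m', m != m' -> exists u, chi m u != chi m' u) ->
  forall (s : seq K) (c : K -> F), uniq s ->
    (forall u, \sum_(m <- s) c m * chi m u = 0) -> {in s, forall m, c m = 0}.
Proof.
move=> chi1 chiM chi_sep; elim=> [//|m0 s IHs] c /= /andP[m0s uniq_s] dep.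
have c_s : {in s, forall m, c m = 0}.
  move=> m ms; have [|v sep] := chi_sep m m0.
    by apply: contraNneq m0s => <-.
  pose c' m1 := c m1 * (chi m1 v - chi m0 v).
  have /IHs-/(_ uniq_s m ms) : forall u, \sum_(m1 <- s) c' m1 * chi m1 u = 0.
    move=> u; have := dep (mul u v); have := dep u.
    rewrite !big_cons => /addr0_eq depu /addr0_eq depuv.
    transitivity (\sum_(j <- s) c j * chi j (mul u v) -
                  (\sum_(j <- s) c j * chi j u) * chi m0 v).
      rewrite mulr_suml -sumrB; apply: eq_bigr => j _.
      rewrite chiM /c' mulrBr mulrBl; congr (_ - _).
        by rewrite -mulrA [chi j v * _]mulrC.
      by rewrite mulrAC.
    by rewrite -depuv -depu chiM mulNr mulrA subrr.
  by move/eqP; rewrite mulf_eq0 subr_eq0 (negPf sep) orbF => /eqP.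
move=> m; rewrite inE => /predU1P[->|/c_s//].
have := dep one; rewrite big_cons chi1 mulr1 big_seq big1 ?addr0 // => j js.
by rewrite c_s // mul0r.
Qed.

Lemma natr_inj_pchar0 (R : idomainType) : [pchar R] =i pred0 ->
  injective (fun n : nat => n%:R : R).
Proof.
move=> /pcharf0P ch0 m n /eqP; wlog le_mn : m n / (m <= n)%N => [hw|].
  by case/orP: (leq_total m n) => /hw // h e; apply/esym/h; rewrite eq_sym.
rewrite eq_sym -subr_eq0 -natrB // ch0 subn_eq0 => le_nm.
by apply/eqP; rewrite eqn_leq le_mn.
Qed.

Section MonomialValues.
Context (F : fieldType) (T : choiceType).

Definition mset_val (A : {mset T}) (u : T -> F) : F := \prod_(t <- A) u t.

Lemma mset_val1 A : mset_val A (fun=> 1) = 1.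
Proof. exact: big1. Qed.

Lemma mset_valM A u v :
  mset_val A (fun t => u t * v t) = mset_val A u * mset_val A v.
Proof. exact: big_split. Qed.

(** Setting a variable [t] of different multiplicities in [A] and [B] to 2 and
    the others to 1 gives distinct powers of 2. *)
Lemma mset_val_sep (A B : {mset T}) : [pchar F] =i pred0 -> A != B ->
  exists u, mset_val A u != mset_val B u.
Proof.
move=> ch0 neqAB.
have /allPn[t _ neq_t] : ~~ all (fun t => A t == B t) (A ++ B).
  apply: contra neqAB => /allP eqAB; apply/mset_eqP => t.
  have [|] := boolP (t \in (A : seq T) ++ B); first by move=> /eqAB/eqP.
  by rewrite mem_cat negb_or => /andP[/mset_eq0P-> /mset_eq0P->].
pose u t' : F := if t' == t then 2 else 1.
have uE C : mset_val C u = (2 ^ C t)%:R.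
  rewrite /mset_val -big_mkcond /= big_const_seq iter_mulr_1 natrX.
  by rewrite -(count_mem_mset t C).
exists u; apply: contra neq_t; rewrite !uE => /eqP/(natr_inj_pchar0 ch0)/eqP.
by rewrite eqn_exp2l.
Qed.

Lemma mset_val_free (s : seq {mset T}) (c : {mset T} -> F) :
    [pchar F] =i pred0 -> uniq s ->
    (forall u, \sum_(A <- s) c A * mset_val A u = 0) ->
  {in s, forall A, c A = 0}.
Proof.
move=> ch0; apply: (character_independence mset_val1 mset_valM) => A B.
exact: mset_val_sep.
Qed.

End MonomialValues.

(** * Homomorphisms and congruences of W-algebras *)

Section ZeroActions.
Context (F : fieldType) (W : algType F) (A : walgebra W).

Lemma wlact0 w : wlact w (0 : A) = 0.
Proof.
have := lact_linr (walgP A) w (-1) 0 0.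
by rewrite scaler0 addr0 scaleN1r addNr.
Qed.

Lemma wract0 w : wract (0 : A) w = 0.
Proof.
have := ract_linl (walgP A) w (-1) 0 0.
by rewrite scaler0 addr0 scaleN1r addNr.
Qed.

End ZeroActions.

Section WhomTheory.
Context (F : fieldType) (W : algType F) (A B : walgebra W) (phi : A -> B).
Hypothesis homphi : is_whom phi.

Lemma whom0 : phi 0 = 0.
Proof.
by rewrite -[0](subrr 0) -scaleN1r addrC (whom_linear homphi) scaleN1r addNr.
Qed.

Lemma whomZ a f : phi (a *: f) = a *: phi f.
Proof. by rewrite -[a *: f]addr0 (whom_linear homphi) whom0 addr0. Qed.

Lemma whomD f g : phi (f + g) = phi f + phi g.
Proof. by rewrite -[f]scale1r (whom_linear homphi) !scale1r. Qed.

Lemma whomB f g : phi (f - g) = phi f - phi g.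
Proof. by rewrite -scaleN1r whomD whomZ scaleN1r. Qed.

(** The left-hand sides of this lemma and of the next two have the shapes of the
    generators: applied to evaluations, these lemmas show that the generators
    vanish on matrices, and turn each generator into a relation between
    arbitrary elements modulo a T_W-ideal. *)
Lemma whom_lact_rel w1 w2 w3 a f :
  phi (wlact w1 (wlact w2 f) - a *: wlact w3 f) =
  wlact w1 (wlact w2 (phi f)) - a *: wlact w3 (phi f).
Proof. by rewrite whomB whomZ !(whom_lact homphi). Qed.

Lemma whom_ract_rel w1 w2 w3 a f :
  phi (wract (wract f w1) w2 - a *: wract f w3) =
  wract (wract (phi f) w1) w2 - a *: wract (phi f) w3.
Proof. by rewrite whomB whomZ !(whom_ract homphi). Qed.

Lemma whom_corner_bracket w f f' g g' : phi f = f' -> phi g = g' ->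
  phi (wbracket (wract (wlact w f) w) (wract (wlact w g) w)) =
  wbracket (wract (wlact w f') w) (wract (wlact w g') w).
Proof.
move=> <- <-.
rewrite /wbracket whomB !(whomM homphi).
by rewrite !(whom_ract homphi) !(whom_lact homphi).
Qed.

End WhomTheory.

Record is_wideal (F : fieldType) (W : algType F) (A : walgebra W)
    (S : A -> Prop) : Prop := IsWIdeal {
  wideal0 : S 0;
  widealD : forall f g, S f -> S g -> S (f + g);
  widealZ : forall c f, S f -> S (c *: f);
  widealMl : forall f g, S g -> S (wmul f g);
  widealMr : forall f g, S f -> S (wmul f g);
  wideal_lact : forall w f, S f -> S (wlact w f);
  wideal_ract : forall f w, S f -> S (wract f w)
}.

Lemma TWideal_wideal (F : fieldType) (W : algType F) (I : choiceType)
  (b : basis W I) (S : freeW b -> Prop) : is_TWideal S -> is_wideal S.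
Proof. by case. Qed.

Section Congruence.
Context (F : fieldType) (W : algType F) (A : walgebra W).
Context (S : A -> Prop) (idS : is_wideal S).

Definition eqmod (f g : A) : Prop := S (f - g).

Local Notation "f == g" := (eqmod f g).

Lemma eqmod_refl f : f == f.
Proof. by rewrite /eqmod subrr; apply: wideal0 idS. Qed.

Lemma eqmod_sym f g : f == g -> g == f.
Proof. by move=> /(widealZ idS (-1)); rewrite scaleN1r opprB. Qed.

Lemma eqmod_trans g f h : f == g -> g == h -> f == h.
Proof. by move=> fg /(widealD idS fg); rewrite addrA subrK. Qed.

Lemma eqmod_lin a f f' g g' : f == f' -> g == g' -> a *: f + g == a *: f' + g'.
Proof.
move=> ff' gg'; rewrite /eqmod opprD addrACA -scalerBr.
exact: widealD idS _ _ (widealZ idS _ ff') gg'.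
Qed.

Lemma eqmod_mull f g g' : g == g' -> wmul f g == wmul f g'.
Proof.
move/(widealMl idS f); rewrite -scaleN1r addrC (mul_linr (walgP A)).
by rewrite scaleN1r addrC.
Qed.

Lemma eqmod_mulr g f f' : f == f' -> wmul f g == wmul f' g.
Proof.
move/(widealMr idS g); rewrite -scaleN1r addrC (mul_linl (walgP A)).
by rewrite scaleN1r addrC.
Qed.

Lemma eqmod_mul f f' g g' : f == f' -> g == g' -> wmul f g == wmul f' g'.
Proof.
move=> ff' gg'; apply: eqmod_trans (eqmod_mull _ gg').
exact: eqmod_mulr.
Qed.

Lemma eqmod_lact w f f' : f == f' -> wlact w f == wlact w f'.
Proof.
move/(wideal_lact idS w); rewrite -scaleN1r addrC (lact_linr (walgP A)).
by rewrite scaleN1r addrC.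
Qed.

Lemma eqmod_ract w f f' : f == f' -> wract f w == wract f' w.
Proof.
move/(wideal_ract idS w); rewrite -scaleN1r addrC (ract_linl (walgP A)).
by rewrite scaleN1r addrC.
Qed.

End Congruence.

(** * Words in the matrix units *)

(** [(j, (c, a))] is the entry of index [(c, a)] of the matrix [x_j]. *)
Definition entry (k : nat) : choiceType := (nat * ('I_k * 'I_k))%type.

Section Words.
Context (F : fieldType) (W : algType F) (k : nat) (J : choiceType).
Context (b : basis W (('I_k * 'I_k) + J)%type).

Local Notation letter := (('I_k * 'I_k) + J)%type.
Local Notation entry := (entry k).

(** The letter preceding a variable is read off from the column index of the
    previous entry and the row index of its own entry, hence the accumulator
    [c]. *)
Fixpoint letters (c : 'I_k) (s : seq entry) : seq (letter * nat) :=
  if s is t :: s' then (inl (c, t.2.1), t.1) :: letters t.2.2 s' else [::].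

(** The monomial [w_{p c_1} x_{j_1} w_{a_1 c_2} ... x_{j_n} w_{a_n q}] for the
    nonempty list of entries [t :: s]. *)
Definition word_mono (p : 'I_k) (t : entry) (s : seq entry) (q : 'I_k) :
    wmono letter :=
  ((inl (p, t.2.1), t.1), letters t.2.2 s,
   inl (last t.2.2 (unzip2 (unzip2 s)), q)).

Lemma word_mono_vars p t s q : mono_vars (word_mono p t s q) = unzip1 (t :: s).
Proof.
rewrite /mono_vars /=; congr cons.
by elim: s t => //= t' s IHs t; rewrite (IHs t').
Qed.

(** Words are taken in an arbitrary W-algebra [A], so that one definition serves
    for monomials of the free algebra ([word_wvar]) and for their values on
    matrices ([word_matrix]). W-algebras have no unit, so the value 0 on the
    empty list is a placeholder. *)
Definition word (A : walgebra W) (x : nat -> A) p (s : seq entry) q : A :=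
  if s is t :: s' then
    let: (h, s'', l) := word_mono p t s' q in weval_mono b x h s'' l
  else 0.

Lemma weval_word_mono (A : walgebra W) (x : nat -> A) p t s q :
  weval (b := b) x (<< word_mono p t s q >> : freeW_car F _) =
  word x p (t :: s) q.
Proof. exact: weval_monoU. Qed.

Lemma word_wvar p t s q :
  (<< word_mono p t s q >> : freeW_car F _) = word (wvar b) p (t :: s) q.
Proof.
rewrite -weval_word_mono; apply: (weval_uniq (phi := id)).
by split=> [? ? ?|||].
Qed.

(** * Commutation of entries modulo the generators *)

Section WordsModIdeal.
Context (A : walgebra W) (x : nat -> A) (S : A -> Prop) (idS : is_wideal S).
Context (o : 'I_k).

Local Notation "f == g" := (eqmod S f g).
Local Notation w i j := (b (inl (i, j))).
Local Notation word := (word x).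

Definition corner (f : A) : A := wract (wlact (w o o) f) (w o o).

Hypothesis unit_lact : forall i j l f,
  wlact (w i j) (wlact (w j l) f) == wlact (w i l) f.
Hypothesis unit_ract : forall i j l f,
  wract (wract f (w i j)) (w j l) == wract f (w i l).
Hypothesis corner_comm : forall f g,
  wmul (corner f) (corner g) == wmul (corner g) (corner f).

Let FP := walgP A.
Let trans := eqmod_trans idS.
Let sym := eqmod_sym idS.
Let refl := eqmod_refl idS.

Lemma word1 p t q :
  word p [:: t] q =
  wlact (w p t.2.1) (wract (x t.1) (w t.2.2 q)).
Proof. by []. Qed.

Lemma word2 p t t' s q :
  word p [:: t, t' & s] q =
  wlact (w p t.2.1) (wmul (x t.1) (word t.2.2 (t' :: s) q)).
Proof. by []. Qed.

Lemma lact_word p c s q : wlact (w p c) (word c s q) == word p s q.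
Proof.
case: s => [|t [|t' s]].
- by rewrite /word wlact0.
- by rewrite !word1; apply: unit_lact.
by rewrite !word2; apply: unit_lact.
Qed.

Lemma ract_word p s c q : wract (word p s c) (w c q) == word p s q.
Proof.
case: s => [|t s].
  by rewrite /word wract0.
elim: s p t => [|t' s IHs] p t.
  rewrite !word1 (lractA FP); apply: eqmod_lact => //; exact: unit_ract.
rewrite !word2 (lractA FP) (ract_mul FP); apply: eqmod_lact => //.
exact/(eqmod_mull idS)/IHs.
Qed.

(** The inner letters [w_{a o}] and [w_{o c}] at the junction merge into
    [w_{a c}]. *)
Lemma word_cat p s s' q : s != [::] -> s' != [::] ->
  wmul (word p s o) (word o s' q) == word p (s ++ s') q.
Proof.
case: s => // t s _; case: s' => // t' s' _.
elim: s p t => [|t1 s IHs] p t.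
  rewrite word1 cat1s word2 -(lact_mul FP) (mul_mid FP).
  by apply/(eqmod_lact idS)/(eqmod_mull idS)/lact_word.
rewrite !cat_cons !word2 -(lact_mul FP) -(wmulA FP).
exact/(eqmod_lact idS)/(eqmod_mull idS)/IHs.
Qed.

Lemma corner_word s : word o s o == corner (word o s o).
Proof.
apply/sym/(trans _ (ract_word o s o o)).
exact/(eqmod_ract idS)/lact_word.
Qed.

Lemma corner_word_comm s s' :
  wmul (word o s o) (word o s' o) == wmul (word o s' o) (word o s o).
Proof.
apply: (trans (eqmod_mul idS (corner_word s) (corner_word s'))).
apply: (trans (corner_comm _ _)).
by apply/sym/(eqmod_mul idS) => //; apply: corner_word.
Qed.

(** Both blocks, once bordered by the index [o], lie in the commutative corner
    of [w_{oo}]. *)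
Lemma word_swap p s s' q : word p (s ++ s') q == word p (s' ++ s) q.
Proof.
have [->|s0] := eqVneq s [::]; first by rewrite cats0.
have [->|s'0] := eqVneq s' [::]; first by rewrite cats0.
have split s1 s2 : s1 != [::] -> s2 != [::] -> word p (s1 ++ s2) q ==
    wlact (w p o) (wract (wmul (word o s1 o) (word o s2 o)) (w o q)).
  move=> s10 s20; apply/sym.
  apply: (trans (eqmod_lact idS _ (eqmod_ract idS _ (word_cat o o s10 s20)))).
  apply: (trans (eqmod_lact idS _ (ract_word _ _ _ _))).
  exact: lact_word.
apply: (trans (split _ _ s0 s'0)); apply/sym/(trans (split _ _ s'0 s0)).
exact/(eqmod_lact idS)/(eqmod_ract idS)/corner_word_comm.
Qed.

(** Swapping two adjacent blocks generates all permutations; a nonempty suffix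
    is first detached by [word_cat]. *)
Lemma word_perm p s s' q : perm_eq s s' -> word p s q == word p s' q.
Proof.
move=> ss'; pose P s1 := word p s q == word p s1 q.
apply: (catCA_perm_ind (P := P)) ss' _; rewrite /P.
  move=> s1 s2 s3 /trans; apply; have [->|s30] := eqVneq s3 [::].
    by rewrite !cats0; apply: word_swap.
  rewrite !catA; have [|s120] := eqVneq (s1 ++ s2) [::].
    by case: s1 s2 => [|? ?] [].
  have s210 : s2 ++ s1 != [::].
    by rewrite -size_eq0 size_cat addnC -size_cat size_eq0.
  apply: trans (word_cat p q s210 s30).
  apply: trans (sym (word_cat p q s120 s30)) _.
  exact/(eqmod_mulr idS)/word_swap.
exact: refl.
Qed.

End WordsModIdeal.

(** * Reading monomials of the free algebra *)

(** Here [c] and [j] come from the part already read: the column index of the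
    last letter, and the variable that follows it. *)
Fixpoint decode_tail (c : 'I_k) (j : nat) (s : seq (letter * nat))
    (l : letter) : option (seq entry * 'I_k) :=
  match s with
  | [::] => if l is inl (a, q) then Some ([:: (j, (c, a))], q) else None
  | (inl (a, c'), j') :: s' =>
      omap (fun r => ((j, (c, a)) :: r.1, r.2)) (decode_tail c' j' s' l)
  | _ => None
  end.

(** Partial inverse of [word_mono], undefined on monomials with a letter in the
    kernel of the action. *)
Definition decode (m : wmono letter) : option ('I_k * seq entry * 'I_k) :=
  let: ((i, j), s, l) := m in
  if i is inl (p, c) then omap (fun r => (p, r.1, r.2)) (decode_tail c j s l)
  else None.

Lemma decode_word_mono p t s q :
  decode (word_mono p t s q) = Some (p, t :: s, q).
Proof.
suff tailE : forall t, decode_tail t.2.1 t.1 (letters t.2.2 s)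
    (inl (last t.2.2 (unzip2 (unzip2 s)), q)) = Some (t :: s, q).
  by rewrite /= tailE.
elim: s => [|t' s IHs] [j [a c]] //=; first by rewrite (IHs t').
Qed.

Lemma decodeP m p s q : decode m = Some (p, s, q) ->
  exists t s', m = word_mono p t s' q /\ s = t :: s'.
Proof.
have tailP s0 : forall c j l s q, decode_tail c j s0 l = Some (s, q) ->
    exists a s', [/\ s = (j, (c, a)) :: s', s0 = letters a s'
                  & l = inl (last a (unzip2 (unzip2 s')), q)].
  elim: s0 => [|[[[a c']|//] j'] s0 IHs] c j l s1 q1 /=.
    by case: l => [[a q']|//] [<- <-]; exists a, [::].
  case E: decode_tail => [[s2 q2]|//] [<- <-] /=.
  have [a' [s' [-> -> ->]]] := IHs _ _ _ _ _ E.
  by exists a, ((j', (c', a')) :: s').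
case: m => [[[[[p' c]|//] j] s0] l] /=.
case E: decode_tail => [[s1 q1]|//] [<- <- <-].
have [a [s' [-> -> ->]]] := tailP _ _ _ _ _ _ E.
by exists (j, (c, a)), s'.
Qed.

Section Reduction.
Context (k_gt1 : (1 < k)%N) (S : freeW b -> Prop) (idS : is_TWideal S).
Hypothesis gensS : forall g, matrix_gens k_gt1 b g -> S g.

Local Notation "f == g" := (eqmod S f g).
Local Notation w i j := (b (inl (i, j))).
Let o := Ordinal (ltnW k_gt1).

(** The generators, stated for variables, hold for arbitrary elements because
    [S] is stable under the endomorphisms of the free algebra, in particular
    under its evaluations in itself. *)
Lemma unit_lact i j l f : wlact (w i j) (wlact (w j l) f) == wlact (w i l) f.
Proof.
have /(TWendo idS (weval_hom _ (fun=> f))) := gensS (GenLeft k_gt1 b i j j l).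
by rewrite (whom_lact_rel (weval_hom b _)) weval_var eqxx scale1r.
Qed.

Lemma unit_ract i j l f : wract (wract f (w i j)) (w j l) == wract f (w i l).
Proof.
have /(TWendo idS (weval_hom _ (fun=> f))) := gensS (GenRight k_gt1 b i j j l).
by rewrite (whom_ract_rel (weval_hom b _)) weval_var eqxx scale1r.
Qed.

Lemma kernel_lact q f : S (wlact (b (inr q)) f).
Proof.
have /(TWendo idS (weval_hom _ (fun=> f))) := gensS (GenLeft0 k_gt1 b q).
by rewrite (whom_lact (weval_hom _ _)) weval_var.
Qed.

Lemma kernel_ract q f : S (wract f (b (inr q))).
Proof.
have /(TWendo idS (weval_hom _ (fun=> f))) := gensS (GenRight0 k_gt1 b q).
by rewrite (whom_ract (weval_hom _ _)) weval_var.
Qed.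

Lemma gens_corner_comm f g :
  wmul (corner o f) (corner o g) == wmul (corner o g) (corner o f).
Proof.
pose rho j := if j is 0 then f else g.
have /(TWendo idS (weval_hom _ rho)) := gensS (GenComm k_gt1 b).
by rewrite (whom_corner_bracket (weval_hom b rho) _
              (weval_var b rho 0) (weval_var b rho 1)).
Qed.

Lemma gens_word_perm p s s' q : perm_eq s s' ->
  word (wvar b) p s q == word (wvar b) p s' q.
Proof.
exact: (word_perm _ (TWideal_wideal idS) unit_lact unit_ract gens_corner_comm).
Qed.

Lemma kernel_head q j s l :
  S (<< (((inr q, j), s, l) : wmono letter) >> : freeW_car F _).
Proof.
by case: s => [|h s]; rewrite (mono_wvar1 b, mono_wvar2 b); apply: kernel_lact.
Qed.

(** Peeling off the variables one by one brings the first letter of the kernel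
    to an end of the monomial. *)
Lemma kernel_mono m : decode m = None -> S (<< m >> : freeW_car F _).
Proof.
have tailP s : forall i c j l, decode_tail c j s l = None ->
    S (<< (((i, j), s, l) : wmono letter) >> : freeW_car F _).
  elim: s => [|[[[a c']|q] j'] s IHs] i c j l /=.
  - case: l => [[a q]//|q] _; rewrite (mono_wvar1 b).
    exact: (TWlact idS _ (kernel_ract _ _)).
  - case E: decode_tail => // _; rewrite (mono_wvar2 b).
    by apply: (TWlact idS); apply: (TWmull idS); apply: IHs E.
  - move=> _; rewrite (mono_wvar2 b).
    by apply: (TWlact idS); apply: (TWmull idS); apply: kernel_head.
case: m => [[[[[p c]|q] j] s] l] /=; last by move=> _; apply: kernel_head.
by case E: decode_tail => // _; apply: tailP E.
Qed.

End Reduction.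

End Words.

(** * Evaluation on matrices and normal forms *)

Lemma delta_mx_sandwich (R : comPzRingType) (n : nat) (a : 'M[R]_n)
    (p i j q : 'I_n) :
  delta_mx p i *m (a *m delta_mx j q) = a i j *: delta_mx p q.
Proof.
(* The matrix unit [e_{jq}] is the column [e_j] times the row [e_q]. *)
rewrite -(mul_delta_mx (0 : 'I_1) j q) [a *m _]mulmxA -colE mulmxA.
have -> : delta_mx p i *m col j a = a i j *: delta_mx p (0 : 'I_1).
  apply/matrixP => r c; rewrite !mxE (bigD1 i) //= !mxE eqxx.
  rewrite big1 => [|i' /negPf ii']; last by rewrite !mxE ii' andbF mul0r.
  by rewrite !ord1 !andbT addr0 mulrC.
by rewrite -scalemxAl mul_delta_mx.
Qed.

Section MatrixAlgebra.
Context (F : fieldType) (W : algType F) (k : nat) (k_gt1 : (1 < k)%N).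
Context (lact : W -> 'M[F]_k -> 'M[F]_k) (ract : 'M[F]_k -> W -> 'M[F]_k).
Context (actP : is_walgebra mulmx lact ract).
Context (J : choiceType) (b : basis W (('I_k * 'I_k) + J)%type).

Let M := WAlgebra actP.

Hypothesis unit_mult : forall i j : 'I_k,
  mult_eq (acting_hom M (b (inl (i, j)))) (inner_mult (delta_mx i j : M)).
Hypothesis kernel_mult : forall q : J,
  mult_eq (acting_hom M (b (inr q))) (mult0 M).

Local Notation entry := (entry k).
Local Notation letter := (('I_k * 'I_k) + J)%type.

Lemma lact_unit i j (a : 'M[F]_k) : lact (b (inl (i, j))) a = delta_mx i j *m a.
Proof. exact: (unit_mult i j).2. Qed.

Lemma ract_unit i j (a : 'M[F]_k) : ract a (b (inl (i, j))) = a *m delta_mx i j.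
Proof. exact: (unit_mult i j).1. Qed.

Lemma lact_kernel q (a : 'M[F]_k) : lact (b (inr q)) a = 0.
Proof. exact: (kernel_mult q).2. Qed.

Lemma ract_kernel q (a : 'M[F]_k) : ract a (b (inr q)) = 0.
Proof. exact: (kernel_mult q).1. Qed.

Lemma word_matrix (rho : nat -> M) p t s q :
  word b rho p (t :: s) q =
  (\prod_(t' <- t :: s) (rho t'.1 : 'M[F]_k) t'.2.1 t'.2.2) *: delta_mx p q
    :> 'M[F]_k.
Proof.
elim: s p t => [|t' s IHs] p t.
  by rewrite word1 big_seq1 /= lact_unit ract_unit delta_mx_sandwich.
rewrite word2 IHs [in RHS]big_cons /= lact_unit -!scalemxAr delta_mx_sandwich.
by rewrite scalerA mulrC.
Qed.

Lemma IdW_TWideal : is_TWideal (IdW b M).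
Proof.
split=> [|f g f0 g0|c f f0|f g g0|f g f0|w f f0|f w f0|phi f homphi f0] rho;
  have homr := weval_hom b rho.
- exact: whom0 homr.
- by rewrite (whomD homr) f0 g0 addr0.
- by rewrite (whomZ homr) f0 scaler0.
- by rewrite (whomM homr) g0; apply: mulmx0.
- by rewrite (whomM homr) f0; apply: mul0mx.
- by rewrite (whom_lact homr) f0 wlact0.
- by rewrite (whom_ract homr) f0 wract0.
have homc : is_whom (weval rho \o phi).
  split=> [a u v|u v|w u|u w] /=.
  - by rewrite (whom_linear homphi) (whom_linear homr).
  - by rewrite (whomM homphi) (whomM homr).
  - by rewrite (whom_lact homphi) (whom_lact homr).
  - by rewrite (whom_ract homphi) (whom_ract homr).
by rewrite -[LHS]/((weval rho \o phi) f) (weval_uniq homc) f0.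
Qed.

Lemma matrix_gens_IdW g : matrix_gens k_gt1 b g -> IdW b M g.
Proof.
case=> [|i j m l|i j m l|q|q] rho; have homr := weval_hom b rho.
- rewrite (whom_corner_bracket homr _ (weval_var b rho 0) (weval_var b rho 1)).
  have cornerE (a : 'M[F]_k) p : delta_mx p p *m a *m delta_mx p p =
      a p p *: delta_mx p p by rewrite -mulmxA delta_mx_sandwich.
  rewrite /wbracket /= !ract_unit !lact_unit !cornerE.
  by rewrite -!scalemxAl -!scalemxAr !scalerA mulrC subrr.
- rewrite (whom_lact_rel homr) weval_var /= !lact_unit mulmxA mul_delta_mx_cond.
  by rewrite -scaler_nat scalemxAl subrr.
- rewrite (whom_ract_rel homr) weval_var /= !ract_unit -mulmxA.
  by rewrite mul_delta_mx_cond -scaler_nat scalemxAr subrr.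
- by rewrite (whom_lact homr) weval_var; apply: lact_kernel.
- by rewrite (whom_ract homr) weval_var; apply: ract_kernel.
Qed.

Local Notation key := ('I_k * {mset entry} * 'I_k)%type.

Definition key_word (K : key) : freeW b := word b (wvar b) K.1.1 K.1.2 K.2.

Definition key_val (rho : nat -> M) (K : key) : 'M[F]_k :=
  mset_val K.1.2 (fun t => (rho t.1 : 'M[F]_k) t.2.1 t.2.2)
    *: delta_mx K.1.1 K.2.

(** The key of a monomial keeps exactly what its values on matrices can see. *)
Definition mono_nf (m : wmono letter) : {malg F[key]} :=
  if decode m is Some (p, s, q) then << (p, seq_mset s, q) >> else 0.

Definition nf (f : freeW b) : {malg F[key]} := lin_ext mono_nf f.

Lemma nf_linear : linear nf.
Proof. exact: lin_ext_is_linear. Qed.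

HB.instance Definition _ :=
  GRing.isLinear.Build F (freeW b) {malg F[key]} *:%R nf nf_linear.

(** This is where the generators are used: monomials with the same key are
    congruent, since their entries differ by a permutation. *)
Lemma eqmod_nf (S : freeW b -> Prop) f : is_TWideal S ->
  (forall g, matrix_gens k_gt1 b g -> S g) ->
  eqmod S f (lin_ext key_word (nf f)).
Proof.
move=> idS gensS; have idS' := TWideal_wideal idS.
elim/malg_lin_ind: f => [|a f g IHf IHg|m].
- by rewrite /nf !linear0; apply: eqmod_refl.
- by rewrite nf_linear lin_ext_is_linear; apply: eqmod_lin.
rewrite /nf lin_extU /mono_nf; case E: (decode m) => [[[p s] q]|].
  have [t [s' [-> ->]]] := decodeP E.
  (* Enumerating the multiset of entries permutes [t :: s']. *)
  rewrite lin_extU (word_wvar b); apply: (gens_word_perm idS gensS).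
  by rewrite perm_sym perm_eq_seq_mset.
by rewrite linear0 /eqmod subr0; apply: (kernel_mono idS gensS).
Qed.

Lemma weval_nf (rho : nat -> M) f : weval rho f = lin_ext (key_val rho) (nf f).
Proof.
elim/malg_lin_ind: f => [|a f g IHf IHg|m].
- by rewrite /nf !linear0 (whom0 (weval_hom b rho)).
- by rewrite nf_linear lin_ext_is_linear (weval_linear rho) IHf IHg.
rewrite /nf lin_extU /mono_nf; case E: (decode m) => [[[p s] q]|].
  have [t [s' [-> ->]]] := decodeP E.
  rewrite lin_extU weval_word_mono word_matrix; congr (_ *: _).
  by apply/perm_big; rewrite perm_sym perm_eq_seq_mset.
by rewrite linear0 (kernel_mono IdW_TWideal matrix_gens_IdW E rho).
Qed.

(** The position [(p, q)] of the matrix value isolates the keys with these outer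
    indices; at generic matrices it is a commutative polynomial whose
    coefficients are those of [nf f]. *)
Lemma IdW_nf (charF : [pchar F] =i pred0) f : IdW b M f <-> nf f = 0.
Proof.
split=> [Idf|nf0 rho]; last by rewrite weval_nf nf0 linear0.
apply/malgP => -[[p A] q]; rewrite mcoeff0.
have [AK|] := boolP ((p, A, q) \in msupp (nf f)); last exact: mcoeff_outdom.
pose s := [seq K.1.2 | K <- msupp (nf f) & (K.1.1 == p) && (K.2 == q)].
(* Keys in [s] differ by their multisets only, so [s] is duplicate-free. *)
have := @mset_val_free F entry s (fun A => (nf f)@_(p, A, q)) charF.
apply; last first.
- by apply/mapP; exists (p, A, q); rewrite // mem_filter /= !eqxx.
- move=> u; pose rho j : M := \matrix_(i, l) u (j, (i, l)).
  have /matrixP/(_ p q) := Idf rho.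
  rewrite weval_nf /lin_ext summxE mxE; apply: etrans.
  rewrite big_map big_filter big_mkcond /=; apply: eq_bigr => -[[p' B] q'] _ /=.
  rewrite !mxE /= [p == _]eq_sym [q == _]eq_sym.
  case: ifP => [/andP[/eqP-> /eqP->]|_].
    rewrite mulr1; congr (_ * _).
    by apply: eq_bigr => -[j [i l]] _; rewrite mxE.
  by rewrite !mulr0.
rewrite map_inj_in_uniq ?filter_uniq ?fset_uniq //.
move=> [[p1 A1] q1] [[p2 A2] q2]; rewrite !mem_filter /=.
by move=> /andP[/andP[/eqP-> /eqP->] _] /andP[/andP[/eqP-> /eqP->] _] ->.
Qed.

End MatrixAlgebra.

(** * Codimensions *)

Lemma quotient_dim_fin (F : fieldType) (V : lmodType F) (P Q : V -> Prop)
    (T : finType) (v : T -> V) :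
    (forall t, P (v t)) ->
    (forall f, P f -> exists! c : {ffun T -> F}, Q (f - \sum_t c t *: v t)) ->
  quotient_dim P Q #|T|.
Proof.
move=> Pv uniqv; exists (v \o enum_val); split=> [i|f Pf]; first exact: Pv.
pose pull (c : {ffun T -> F}) : {ffun 'I_#|T| -> F} :=
  [ffun i => c (enum_val i)].
pose push (c : {ffun 'I_#|T| -> F}) : {ffun T -> F} :=
  [ffun t => c (enum_rank t)].
have pushK c : pull (push c) = c by apply/ffunP => i; rewrite !ffunE enum_valK.
have sumE c : \sum_i pull c i *: (v \o enum_val) i = \sum_t c t *: v t.
  rewrite [RHS](reindex _ (onW_bij _ (enum_val_bij T))).
  by apply: eq_bigr => i _; rewrite ffunE.
have [c [Qc uniqc]] := uniqv f Pf.
exists (pull c); split=> [|c']; first by rewrite sumE.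
by rewrite -(pushK c') sumE => /uniqc->.
Qed.

Section Codimension.
Context (F : fieldType) (W : algType F) (k : nat) (k_gt1 : (1 < k)%N).
Context (lact : W -> 'M[F]_k -> 'M[F]_k) (ract : 'M[F]_k -> W -> 'M[F]_k).
Context (actP : is_walgebra mulmx lact ract).
Context (J : choiceType) (b : basis W (('I_k * 'I_k) + J)%type).

Let M := WAlgebra actP.

Hypothesis unit_mult : forall i j : 'I_k,
  mult_eq (acting_hom M (b (inl (i, j)))) (inner_mult (delta_mx i j : M)).
Hypothesis kernel_mult : forall q : J,
  mult_eq (acting_hom M (b (inr q))) (mult0 M).
Hypothesis charF : [pchar F] =i pred0.

Local Notation entry := (entry k).
Context (n : nat).

Definition index_entries (g : {ffun 'I_n.+1 -> 'I_k * 'I_k}) : seq entry :=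
  [seq (val j, g j) | j <- enum 'I_n.+1].

Lemma unzip1_index_entries g : unzip1 (index_entries g) = iota 0 n.+1.
Proof. by rewrite /unzip1 -map_comp -val_enum_ord. Qed.

Lemma index_entries_inj g g' :
  perm_eq (index_entries g) (index_entries g') -> g = g'.
Proof.
move=> /perm_mem eq_gg'; apply/ffunP => j.
have := eq_gg' (val j, g j); rewrite map_f ?mem_enum //.
by case/esym/mapP => j' _ [/val_inj-> ->].
Qed.

(** In a multilinear monomial each variable owns one entry, found by looking up
    the position of the variable. *)
Lemma index_entries_surj (s : seq entry) : perm_eq (unzip1 s) (iota 0 n.+1) ->
  exists g, perm_eq s (index_entries g).
Proof.
move=> perm_s; have uniq_s : uniq (unzip1 s).
  by rewrite (perm_uniq perm_s) iota_uniq.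
case: s perm_s uniq_s => [/perm_size//|t s] perm_s uniq_s.
pose look j := nth t (t :: s) (index j (unzip1 (t :: s))).
have look1 j : j \in unzip1 (t :: s) -> (look j).1 = j.
  move=> js; rewrite /look -(nth_map t 0%N) ?nth_index //.
  by rewrite -(size_map fst) index_mem.
exists [ffun j : 'I_n.+1 => (look j).2].
have -> : index_entries [ffun j : 'I_n.+1 => (look j).2] =
    map look (iota 0 n.+1).
  rewrite /index_entries -val_enum_ord -[RHS]map_comp; apply: eq_map => j /=.
  have /look1 : \val j \in unzip1 (t :: s).
    by rewrite (perm_mem perm_s) mem_iota ltn_ord.
  by rewrite ffunE; case: (look j) => a c /= ->.
have {1}-> : t :: s = map look (unzip1 (t :: s)); last exact: perm_map.
apply: (@eq_from_nth _ t); rewrite ?size_map // => i lt_i.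
by rewrite (nth_map 0%N) ?size_map // /look index_uniq ?size_map.
Qed.

Local Notation gen_index :=
  ({ffun 'I_n.+1 -> 'I_k * 'I_k} * ('I_k * 'I_k))%type.

Definition gen_key (t : gen_index) : 'I_k * {mset entry} * 'I_k :=
  (t.2.1, seq_mset (index_entries t.1), t.2.2).

Lemma gen_key_inj : injective gen_key.
Proof.
by move=> [g [p q]] [g' [p' q']] [-> /eq_seq_msetP/index_entries_inj-> ->].
Qed.

Definition gen_word (t : gen_index) : freeW b :=
  word b (wvar b) t.2.1 (index_entries t.1) t.2.2.

Lemma gen_wordE t : exists m, [/\ gen_word t = (<< m >> : freeW_car F _),
  mono_vars m = iota 0 n.+1 & mono_nf F m = << gen_key t >>].
Proof.
case: t => [g [p q]]; have := unzip1_index_entries g.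
rewrite /gen_word /gen_key /=; case: (index_entries g) => // t s st.
exists (word_mono _ p t s q); split; first by rewrite -(word_wvar b).
  by rewrite word_mono_vars.
by rewrite /mono_nf decode_word_mono.
Qed.

Lemma nf_gen_word t : nf (gen_word t) = << gen_key t >>.
Proof. by have [m [-> _ <-]] := gen_wordE t; apply: lin_extU. Qed.

(** All keys of multilinear polynomials are among the [gen_key t], which makes
    the [gen_word t] span modulo the identities. *)
Lemma mcoeff_nf_multilinear f K : multilinear_poly b n.+1 f ->
  ~~ [exists t, gen_key t == K] -> (nf f)@_K = 0.
Proof.
move=> lin_f; apply: contraNeq; rewrite /nf /lin_ext raddf_sum /= => nz.
have [m mf nz_m] : exists2 m, m \in msupp (f : freeW_car F _) &
    (mono_nf F m)@_K != 0.
  apply/hasP; apply: contraNT nz => /hasPn z; rewrite big_seq big1 // => m /z.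
  by rewrite negbK mcoeffZ => /eqP->; rewrite mulr0.
move: nz_m; rewrite /mono_nf; case E: (decode m) => [[[p s] q]|]; last first.
  by rewrite mcoeff0 eqxx.
rewrite mcoeffU; case: (_ =P K) => [<- _|]; last by rewrite eqxx.
have [t [s' [m_eq s_eq]]] := decodeP E.
have [|g gs] := index_entries_surj (s := s).
  by rewrite s_eq -(word_mono_vars J p t s' q) -m_eq; apply: lin_f.
apply/existsP; exists (g, (p, q)); rewrite /gen_key /=.
by have /eq_seq_msetP-> := gs.
Qed.

(** The coefficients of [f] modulo the identities are forced to be those of
    [nf f] at the keys [gen_key t]. *)
Lemma codim_matrix : codimW b M n.+1 (k ^ (2 * (n.+1 + 1)))%N.
Proof.
have -> : (k ^ (2 * (n.+1 + 1)) = #|{: gen_index}|)%N.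
  rewrite card_prod card_ffun !card_prod !card_ord mulnn -expnM -expnD.
  by rewrite mulnDr muln1.
apply: (quotient_dim_fin (v := gen_word)) => [t m|f lin_f].
  have [m' [-> vars_m' _]] := gen_wordE t.
  by rewrite msuppU oner_eq0 inE => /eqP->; rewrite vars_m'.
have nf_comb (c : {ffun gen_index -> F}) K :
    (nf (f - \sum_t c t *: gen_word t))@_K =
    (nf f)@_K - \sum_t c t * (gen_key t == K)%:R.
  rewrite linearB mcoeffB; congr (_ - _); rewrite linear_sum raddf_sum /=.
  by apply: eq_bigr => t _; rewrite linearZ /= mcoeffZ nf_gen_word mcoeffU.
have sumE (c : {ffun gen_index -> F}) t :
    \sum_t' c t' * (gen_key t' == gen_key t)%:R = c t.
  rewrite (bigD1 t) //= eqxx mulr1 big1 ?addr0 // => t' /negPf neq.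
  by rewrite (inj_eq gen_key_inj) neq mulr0.
have IdE (c : {ffun gen_index -> F}) :
    IdW b M (f - \sum_t c t *: gen_word t) <->
    forall t, c t = (nf f)@_(gen_key t).
  rewrite (IdW_nf k_gt1 unit_mult kernel_mult charF); split=> [nf0 t|cE].
    have := nf_comb c (gen_key t); rewrite nf0 mcoeff0 sumE => /esym/eqP.
    by rewrite subr_eq0 => /eqP->.
  apply/malgP => K; rewrite nf_comb mcoeff0.
  have [/existsP[t /eqP<-]|noK] := boolP [exists t, gen_key t == K].
    by rewrite sumE cE subrr.
  rewrite mcoeff_nf_multilinear // big1 ?subrr // => t _.
  by move/existsPn/(_ t)/negPf: noK => ->; rewrite mulr0.
exists [ffun t => (nf f)@_(gen_key t)]; split.
  by apply/IdE => t; rewrite ffunE.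
by move=> c /IdE cE; apply/ffunP => t; rewrite ffunE cE.
Qed.

End Codimension.

Theorem theorem5p2 (F : fieldType) (charF : [pchar F] =i pred0)
    (W : algType F) (k : nat) (k_gt1 : (1 < k)%N)
    (lact : W -> 'M[F]_k -> 'M[F]_k) (ract : 'M[F]_k -> W -> 'M[F]_k)
    (actP : is_walgebra mulmx lact ract)
    (J : choiceType) (b : basis W (('I_k * 'I_k) + J)%type) :
  let M := WAlgebra actP in
  acts_as_itself M ->
  (forall i j : 'I_k,
     mult_eq (acting_hom M (b (inl (i, j)))) (inner_mult (delta_mx i j : M))) ->
  (forall q : J, mult_eq (acting_hom M (b (inr q))) (mult0 M)) ->
  (forall f : freeW b, IdW b M f <-> TWgen (matrix_gens k_gt1 b) f) /\
  (forall n : nat, (0 < n)%N -> codimW b M n (k ^ (2 * (n + 1)))%N).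
Proof.
move=> M _ unit_mult kernel_mult; split=> [f|[//|n] _]; last first.
  exact: codim_matrix.
split=> [Idf S idS gensS|]; last first.
  apply; first exact: IdW_TWideal.
  exact: (matrix_gens_IdW unit_mult kernel_mult).
have := eqmod_nf f idS gensS.
have /(IdW_nf k_gt1 unit_mult kernel_mult charF)-> := Idf.
by rewrite linear0 /eqmod subr0.
Qed.
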